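(* Let $\Gamma=(X,R)$ be a bipartite distance-regular graph with even diameter $D\ge4$ and valency $k\ge3$, let $d=D/2$, fix $x\in X$, let $W$ be a thin irreducible $T(x)$-module with endpoint $2$ and local eigenvalue $\tilde\theta_d$, and let $v$ be a nonzero vector in $E^*_2W$. Then the vectors $E^*_{i+2}A_iv$ $(0\le i\le D-3)$ are mutually orthogonal and $$\|E^*_{i+2}A_iv\|^2=-\frac{k_ib_ib_{i+1}c_{i+1}c_{i+2}}{k\,b_1b_2}\,\frac{P_{i+2}(0)}{P_i(0)}\,\|v\|^2\qquad(0\le i\le D-3).$$
   Context: $\Gamma$ is a finite connected bipartite distance-regular graph with distance $\partial$, intersection numbers $c_i,b_i$ ($c_0=0,b_D=0$), $k_i=b_0\cdots b_{i-1}/(c_1\cdots c_i)$. $A_i$ are the distance matrices, $A=A_1$, eigenvalues $\theta_0>\dots>\theta_D$. $V=\mathbb{C}^X$ with $\langle u,w\rangle=u^t\bar w$, $\|u\|^2=\langle u,u\rangle$. $E^*_i$ is diagonal with $(y,y)$-entry $1$ if $\partial(x,y)=i$, else $0$; $T(x)$ is generated by $A,E^*_0,\dots,E^*_D$; thin: $\dim E^*_iW\le1$ for all $i$; endpoint: $\min\{i:E^*_iW\ne0\}$; local eigenvalue of thin irreducible $W$ with endpoint 2: the eigenvalue of $E^*_2A_2E^*_2$ on $E^*_2W$. $\tilde\theta_d=-1-b_2b_3(\theta_d^2-b_2)^{-1}$. Polynomials: $f_0=1,f_{-1}=0$, $\lambda f_i=b_{i-1}f_{i-1}+c_{i+1}f_{i+1}$;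 $p_i=f_i+f_{i-2}+\cdots$ (ending in $f_0$ or $f_1$ according to parity of $i$); $P_i$ is defined by $p_i(\lambda)=P_i(\lambda^2)$ for $i$ even and $p_i(\lambda)=\lambda P_i(\lambda^2)$ for $i$ odd. *)

(* Defs.v *)
From HB Require Import structures.
From mathcomp Require Import all_boot all_order all_algebra.
From mathcomp Require Import reals.
From mathcomp.real_closed Require Import complex.

Set Implicit Arguments.
Unset Strict Implicit.
Unset Printing Implicit Defensive.

Import Order.TTheory GRing.Theory Num.Theory.
Local Open Scope ring_scope.

Section Graph.
Variables (X : finType) (e : rel X).
Implicit Types y z : X.

Definition simple_graph : Prop := symmetric e /\ irreflexive e.

Definition connected_graph : Prop := forall y z, connect e y z.

Definition bipartite_graph : Prop :=
  exists S : {set X}, forall y z, e y z -> (y \in S) != (z \in S).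

Definition walk_of_length y z (n : nat) : bool :=
  [exists q : n.-tuple X, path e y q && (last y q == z)].

(* The least length of a walk from y to z. Shortest walks have length < #|X|,
   so searching 0, ..., #|X|-1 suffices; the value is the dummy #|X| when z is
   not reachable from y. *)
Definition dist y z : nat := find (walk_of_length y z) (iota 0 #|X|).

Lemma dist_walk y z : connect e y z ->
  walk_of_length y z (dist y z) /\
  forall n, walk_of_length y z n -> (dist y z <= n)%N.
Proof.
move=> /connectP[q yq ->{z}].
case/shortenP: yq => q' yq' uq' _; set z := last y q'.
have lt_q' : (size q' < #|X|)%N by have := max_card (mem (y :: q')); rewrite (card_uniqP uq').
have wq' : walk_of_length y z (size q').
  by apply/existsP; exists (in_tuple q'); rewrite /= yq' eqxx.
have has_w : has (walk_of_length y z) (iota 0 #|X|).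
  by apply/hasP; exists (size q') => //; rewrite mem_iota.
have lt_d : (dist y z < #|X|)%N by rewrite -(size_iota 0 #|X|) -has_find.
split; first by have := nth_find 0%N has_w; rewrite nth_iota.
move=> n wn; rewrite leqNgt; apply/negP => lt_nd.
have := before_find 0%N lt_nd.
by rewrite nth_iota ?(ltn_trans lt_nd) // add0n wn.
Qed.

Definition diameter : nat := \max_(y : X) \max_(z : X) dist y z.

Definition num_at (i j : nat) y z : nat := #|[set w | (dist y w == i) && (dist w z == j)]|.

Definition distance_regular : Prop :=
  forall (i j : nat) y z y' z', dist y z = dist y' z' ->
    num_at i j y z = num_at i j y' z'.

(* p^h_{ij}, read off at some pair at distance h; 0 if there is no such pair. *)
Definition inter_num (h i j : nat) : nat :=
  if [pick yz : X * X | dist yz.1 yz.2 == h] is Some yz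
  then num_at i j yz.1 yz.2 else 0%N.

Definition cnum (i : nat) : nat :=
  if i is i'.+1 then inter_num i 1%N i' else 0%N.

Definition bnum (i : nat) : nat := inter_num i 1%N i.+1.

Definition valency : nat := bnum 0.

End Graph.

Section Polynomials.
Variables (X : finType) (e : rel X) (F : numFieldType).
Local Notation c i := ((cnum e i)%:R : F).
Local Notation b i := ((bnum e i)%:R : F).

Definition kval (i : nat) : F :=
  (\prod_(0 <= j < i) b j) / (\prod_(1 <= j < i.+1) c j).

(* The recurrence 'X * f_i = b_{i-1} f_{i-1} + c_{i+1} f_{i+1}, with f_{-1} = 0,
   solved for f_{i+1}; relevant for i + 1 <= D, where c_{i+1} != 0. *)
Fixpoint fpoly (i : nat) : {poly F} :=
  match i with
  | 0 => 1
  | (i'.+1 as i1) =>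
      (c i)^-1 *: (if i' is j.+1 then 'X * fpoly i' - b j *: fpoly j
                   else 'X * fpoly i')
  end.

Definition ppoly (i : nat) : {poly F} :=
  \sum_(j < i.+1 | odd j == odd i) fpoly j.

Definition Ppoly (i : nat) : {poly F} :=
  if odd i then odd_poly (ppoly i) else even_poly (ppoly i).

Lemma fpoly_parity i k : odd k != odd i -> (fpoly i)`_k = 0.
Proof.
suff [] : (forall k, odd k != odd i -> (fpoly i)`_k = 0) /\
          (forall k, odd k == odd i -> (fpoly i.+1)`_k = 0) by move=> H _; apply: H.
elim: i {k} => [|i [IH0 IH1]].
  split=> [[|k]|[|k]]; rewrite /= ?coefC ?coefZ ?mulr1 ?coefX //.
    by rewrite mulr0.
  by case: k => // k; rewrite mulr0.
split=> k kP; first by apply: IH1; move: kP => /=; case: (odd k); case: (odd i).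
have -> : fpoly i.+2 = (c i.+2)^-1 *: ('X * fpoly i.+1 - b i *: fpoly i) by [].
rewrite coefZ coefB coefXM (coefZ (b i)).
rewrite IH0 ?mulr0 ?subr0; last by move: kP => /=; case: (odd k); case: (odd i).
case: k kP => [|k] kP /=; first by rewrite mulr0.
have -> := IH1 k; first by rewrite mulr0.
by move: kP => /=; case: (odd k); case: (odd i).
Qed.

Lemma PpolyE i :
  ppoly i = if odd i then 'X * (Ppoly i \Po 'X^2) else Ppoly i \Po 'X^2.
Proof.
have par k : odd k != odd i -> (ppoly i)`_k = 0.
  move=> ki; rewrite coef_sum big1 // => j /eqP ji.
  by apply: fpoly_parity; rewrite ji.
rewrite /Ppoly -{1}[ppoly i]poly_even_odd; case: ifP => oi.
  have -> : even_poly (ppoly i) = 0.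
    by apply/polyP => k; rewrite coef_even_poly coef0 par // odd_double oi.
  by rewrite comp_poly0 add0r oi mulrC.
have -> : odd_poly (ppoly i) = 0.
  by apply/polyP => k; rewrite coef_odd_poly coef0 par //= odd_double oi.
by rewrite comp_poly0 mul0r addr0 oi.
Qed.

(* -1 - b_2 b_3 (t^2 - b_2)^-1, as a function of t = theta_d *)
Definition tilde_eig (t : F) : F := -1 - b 2%N * b 3%N * (t ^+ 2 - b 2%N)^-1.

End Polynomials.

(* Matrices and column vectors indexed by X, through enum_val : 'I_#|X| -> X. *)
Section Terwilliger.
Variables (R : realType) (X : finType) (e : rel X).
Local Notation C := (R[i]).
Local Notation V := ('cV[C]_#|X|).
Local Notation M := ('M[C]_#|X|).

Definition Adist (i : nat) : M :=
  \matrix_(y, z) (dist e (enum_val y) (enum_val z) == i)%:R.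

Definition Estar (x : X) (i : nat) : M :=
  \matrix_(y, z) ((y == z) && (dist e x (enum_val y) == i))%:R.

Definition inner (u w : V) : C := \sum_y u y 0 * (w y 0)^*.

Definition sqnorm (u : V) : C := inner u u.

(* theta 0 > ... > theta D are the distinct eigenvalues of A; the values of
   theta beyond D are irrelevant. *)
Definition ordered_eigenvalues (theta : nat -> R) : Prop :=
  (forall i j, (i < j <= diameter e)%N -> theta j < theta i) /\
  (forall z : C, eigenvalue (Adist 1) z <->
     exists2 i, (i <= diameter e)%N & z = (theta i)%:C%C).

Inductive in_T (x : X) : M -> Prop :=
| T_adj : in_T x (Adist 1)
| T_Estar i : (i <= diameter e)%N -> in_T x (Estar x i)
| T_one : in_T x 1%:M
| T_lin (a : C) (B B' : M) : in_T x B -> in_T x B' -> in_T x (a *: B + B')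
| T_mul (B B' : M) : in_T x B -> in_T x B' -> in_T x (B *m B').

Definition T_module (x : X) (W : {vspace V}) : Prop :=
  forall B w, in_T x B -> w \in W -> B *m w \in W.

Definition T_irreducible (x : X) (W : {vspace V}) : Prop :=
  [/\ T_module x W, W != 0%VS &
      forall U : {vspace V}, T_module x U -> (U <= W)%VS -> U = 0%VS \/ U = W].

Definition EW (x : X) (W : {vspace V}) (i : nat) : {vspace V} :=
  (linfun (mulmx (Estar x i)) @: W)%VS.

Definition thin (x : X) (W : {vspace V}) : Prop :=
  forall i, (i <= diameter e)%N -> (\dim (EW x W i) <= 1)%N.

Definition has_endpoint (x : X) (W : {vspace V}) (r : nat) : Prop :=
  EW x W r != 0%VS /\ forall i, EW x W i != 0%VS -> (r <= i)%N.

(* Meant for thin W with endpoint 2: then E*_2 W is a line, and eta is the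
   scalar by which E*_2 A_2 E*_2 acts on it. *)
Definition has_local_eigenvalue (x : X) (W : {vspace V}) (eta : C) : Prop :=
  forall w, w \in EW x W 2 ->
    (Estar x 2 *m Adist 2 *m Estar x 2) *m w = eta *: w.

End Terwilliger.

(* Main.v *)
Require Import Defs.
From mathcomp Require Import all_boot all_order all_algebra.
From mathcomp Require Import reals.
From mathcomp.real_closed Require Import complex.
From mathcomp Require Import zify ring.
Set Implicit Arguments.
Unset Strict Implicit.
Unset Printing Implicit Defensive.
Import Order.TTheory GRing.Theory Num.Theory.
Local Open Scope ring_scope.

(* The spectrum of a bipartite graph is symmetric, so theta_d = 0 and the local
   eigenvalue is b_3 - 1.  Write g_i = E*_{i+2} A_i v.  Since v is orthogonal to
   the all-ones vector,
     g_i + E*_{i+2} A_{i+2} v + E*_{i+2} A_{i+4} v = 0,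
   and thinness gives E*_{i+2} A_{i+4} v = - Y_i g_i as long as g_i <> 0.
   Applying E*_{i+2} to A A_{j+1} v = b_j A_j v + c_{j+2} A_{j+2} v with j = i
   gives E*_{i+2} A g_{i+1} = L_i g_i, where L_i depends only on Y_i and Y_{i-1};
   with j = i + 2 it gives Y_{i+1} L_i = b_{i+4} Y_i.  As E*_{i+3} A g_i =
   c_{i+1} g_{i+1} and A is symmetric, c_{i+1} |g_{i+1}|^2 = L_i |g_i|^2.
   The recurrence c_{i+2} P_{i+2}(0) = [i odd] P_{i+1}(0) - b_{i+2} P_i(0) solves
   these relations in closed form and shows that (-1)^(i/2) P_i(0) > 0 for i < D,
   so that no L_i, hence no g_i, vanishes. *)

(** * Path-length metric of a connected graph, and its parity in the bipartite case *)

Section Distance.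
Variables (X : finType) (e : rel X).
Hypotheses (Gsimple : simple_graph e) (Gconn : connected_graph e).
Implicit Types x y z w : X.

Lemma walkP y z n :
  reflect (exists q, [/\ size q = n, path e y q & last y q = z])
          (walk_of_length e y z n).
Proof.
apply: (iffP existsP) => [[q /andP[pq /eqP lq]]|[q [sq pq lq]]].
  by exists q; rewrite size_tuple.
by move/eqP: sq => sq; exists (Tuple sq); rewrite /= pq lq eqxx.
Qed.

Lemma dist_walkE y z : walk_of_length e y z (dist e y z).
Proof. by have [] := dist_walk (Gconn y z). Qed.

Lemma dist_le_walk y z n : walk_of_length e y z n -> (dist e y z <= n)%N.
Proof. by have [_] := dist_walk (Gconn y z); apply. Qed.

Lemma walk_sym y z n : walk_of_length e y z n -> walk_of_length e z y n.
Proof.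
case: Gsimple => esym _ /walkP[q [<- pq <-]]; apply/walkP.
exists (rev (belast y q)); split; first by rewrite size_rev size_belast.
  by rewrite rev_path; apply: sub_path pq => a b; rewrite esym.
by case: q {pq} => //= a q; rewrite rev_cons last_rcons.
Qed.

Lemma dist_sym y z : dist e y z = dist e z y.
Proof.
by apply/eqP; rewrite eqn_leq !dist_le_walk // walk_sym // dist_walkE.
Qed.

Lemma dist_triangle w y z : (dist e y z <= dist e y w + dist e w z)%N.
Proof.
have /walkP[q [sq pq lq]] := dist_walkE y w.
have /walkP[r [sr pr lr]] := dist_walkE w z.
apply/dist_le_walk/walkP; exists (q ++ r).
by rewrite size_cat sq sr cat_path last_cat pq lq pr lr.
Qed.

Lemma dist_eq0 y z : (dist e y z == 0%N) = (y == z).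
Proof.
apply/eqP/eqP => [d0|->].
  by have := dist_walkE y z; rewrite d0 => /walkP[[|? ?] [] //].
by apply/eqP; rewrite -leqn0; apply/dist_le_walk/walkP; exists [::].
Qed.

(** A shortest walk is cut after [m] steps. Each piece bounds a distance from above, and the
    triangle inequality forces equality in both bounds. *)
Lemma dist_split y z m n : dist e y z = (m + n)%N ->
  exists w, dist e y w = m /\ dist e w z = n.
Proof.
move=> dyz; have /walkP[q [sq pq lq]] := dist_walkE y z.
rewrite -(cat_take_drop m q) in pq lq; pose w := last y (take m q).
move: pq lq; rewrite cat_path last_cat => /andP[p1 p2] lq.
have le1 : (dist e y w <= m)%N.
  apply/dist_le_walk/walkP; exists (take m q).
  by rewrite size_takel // sq dyz leq_addr.
have le2 : (dist e w z <= n)%N.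
  apply/dist_le_walk/walkP; exists (drop m q).
  by rewrite size_drop sq dyz addKn.
by exists w; have := dist_triangle w y z; lia.
Qed.

Lemma dist_le_diameter y z : (dist e y z <= diameter e)%N.
Proof.
by apply: leq_trans (leq_bigmax y); apply: (leq_bigmax (F := dist e y)).
Qed.

(** The vertex [x] makes the graph nonempty, so the maxima defining the diameter are attained; a
    geodesic between two vertices at maximal distance is then cut at step [h]. *)
Lemma ex_dist x h : (h <= diameter e)%N -> exists y z, dist e y z = h.
Proof.
move=> hD.
have X0 : (0 < #|X|)%N by apply/card_gt0P; exists x.
have [y Dy] := @bigop.eq_bigmax X (fun y => \max_z dist e y z) X0.
have [z Dz] := @bigop.eq_bigmax X (dist e y) X0.
have dyz : dist e y z = (h + (diameter e - h))%N by rewrite subnKC // -Dz -Dy.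
by have [w [<- _]] := dist_split dyz; exists y, w.
Qed.

Section Bipartite.
Variable S : {set X}.
Hypothesis bipS : forall y z, e y z -> (y \in S) != (z \in S).

(** Each edge of a walk changes sides of the bipartition. *)
Lemma odd_dist y z : odd (dist e y z) = (y \in S) (+) (z \in S).
Proof.
have /walkP[q [<- pq <-]] := dist_walkE y z.
elim: q y pq => [|a q IHq] y /=; first by rewrite addbb.
case/andP=> /bipS ya /IHq ->; move: ya.
by case: (y \in S); case: (a \in S); case: (_ \in S).
Qed.

Lemma odd_dist_triangle w y z :
  odd (dist e y z) = odd (dist e y w) (+) odd (dist e w z).
Proof. by rewrite !odd_dist addbA addbK. Qed.

End Bipartite.

End Distance.

(** * Counting neighbours: the intersection numbers of a bipartite distance-regular graph *)

Section IntersectionNumbers.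
Variables (X : finType) (e : rel X) (x : X).
Hypotheses (Gsimple : simple_graph e) (Gconn : connected_graph e).
Hypotheses (Gbip : bipartite_graph e) (Gdr : distance_regular e).
Implicit Types y z w : X.
Local Notation D := (diameter e).

Lemma dist_parity w y z :
  odd (dist e y z) = odd (dist e y w) (+) odd (dist e w z).
Proof. by have [S bS] := Gbip; apply: (odd_dist_triangle _ bS). Qed.

Lemma inter_numE h i j y z :
  dist e y z = h -> inter_num e h i j = num_at e i j y z.
Proof.
move=> dyz; rewrite /inter_num; case: pickP => [yz /eqP dh|/(_ (y, z))] /=.
  by apply: Gdr; rewrite dh.
by rewrite dyz eqxx.
Qed.

Lemma cnum_num_at h y z :
  dist e y z = h.+1 -> num_at e 1 h y z = cnum e h.+1.
Proof. by move=> dyz; rewrite /cnum (inter_numE _ _ dyz). Qed.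

Lemma bnum_num_at h y z :
  dist e y z = h -> num_at e 1 h.+1 y z = bnum e h.
Proof. by move=> dyz; rewrite /bnum (inter_numE _ _ dyz). Qed.

(** Moving along an edge changes the distance to [z] by at most one, by the triangle inequality, and
    cannot preserve it, by parity. *)
Lemma dist_neighbor w y z h : dist e y w = 1%N -> dist e y z = h ->
  dist e w z = h.+1 \/ (0 < h)%N /\ dist e w z = h.-1.
Proof.
move=> yw yz; have := dist_parity w y z; rewrite yw yz /= => par.
have := dist_triangle Gconn w y z; have := dist_triangle Gconn y w z.
rewrite (dist_sym Gsimple Gconn w y) yw yz => t1 t2.
suff : dist e w z != h by lia.
by apply/eqP => wz; move: par; rewrite wz; case: odd.
Qed.

(** The alternative [i = 0] is there because [i.-1] truncates: in that case distance [i.-1 = 0] is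
    not a genuine predecessor of [i]. *)
Lemma num_at_eq0 i y z : dist e y z != i.+1 -> dist e y z != i.-1 \/ i = 0%N ->
  num_at e 1 i y z = 0%N.
Proof.
move=> n1 n2; apply/eqP; rewrite cards_eq0; apply/eqP/setP => w; rewrite !inE.
apply/negP => /andP[/eqP yw /eqP wz].
have := dist_neighbor yw (erefl (dist e y z)); rewrite wz; move: n1 n2 => /eqP n1.
by case=> [/eqP|]; lia.
Qed.

Lemma cnum_gt0 h : (0 < h <= D)%N -> (0 < cnum e h)%N.
Proof.
case: h => // h hD; have [y [z dyz]] := ex_dist Gconn x hD.
rewrite -(cnum_num_at dyz); apply/card_gt0P.
have [w [yw wz]] := @dist_split _ _ Gconn y z 1 h dyz.
by exists w; rewrite inE yw wz !eqxx.
Qed.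

Lemma bnum_gt0 h : (h < D)%N -> (0 < bnum e h)%N.
Proof.
move=> hD; have [y [z dyz]] := ex_dist Gconn x hD.
(* The pair to count from is [w], [z]: it is at distance [h], and [y] is a neighbour of [w] one step
   further from [z]. *)
have [w [yw wz]] := @dist_split _ _ Gconn y z 1 h dyz.
rewrite -(bnum_num_at wz); apply/card_gt0P; exists y.
by rewrite inE dyz (dist_sym Gsimple Gconn w y) yw !eqxx.
Qed.

Lemma cnum1 : (0 < D)%N -> cnum e 1 = 1%N.
Proof.
move=> hD; have [y [z dyz]] := ex_dist Gconn x hD.
rewrite -(@cnum_num_at 0 y z dyz); apply/eqP/cards1P.
exists z; apply/setP => w.
rewrite !inE dist_eq0 //; case: (w =P z) => [->|]; first by rewrite dyz.
by rewrite andbF.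
Qed.

Lemma cnum_add_bnum h : (h <= D)%N -> (cnum e h + bnum e h)%N = valency e.
Proof.
move=> hD; have [y [z dyz]] := ex_dist Gconn x hD.
have dyy : dist e y y = 0%N by apply/eqP; rewrite dist_eq0.
rewrite /valency -(bnum_num_at dyy) -(bnum_num_at dyz).
(* By parity a neighbour of [y] that is not at distance [h.+1] from [z] is at distance [h.-1], so
   [c_h] counts the complement of the set counted by [b_h]; for [h = 0] both sides vanish. *)
have -> : cnum e h = #|[set w | (dist e y w == 1)%N & (dist e w z != h.+1)%N]|.
  case: h hD dyz => [|h] hD dyz.
    apply/esym/eqP; rewrite cards_eq0; apply/eqP/setP => w; rewrite !inE.
    apply/negP => /andP[/eqP yw] /eqP.
    by have := dist_neighbor yw dyz; lia.
  rewrite -(cnum_num_at dyz); apply: eq_card => w; rewrite !inE.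
  case: eqP => //= yw; have := dist_neighbor yw dyz.
  by move: (dist e w z) => n nP; lia.
rewrite addnC -[RHS](cardsID [set w | dist e w z == h.+1]).
congr (_ + _)%N; apply: eq_card => w; rewrite !inE.
  by rewrite (dist_sym Gsimple Gconn w y) andbb.
by rewrite (dist_sym Gsimple Gconn w y) andbb andbC.
Qed.

End IntersectionNumbers.

(** * Dual idempotents, distance matrices and the Hermitian form *)

Section Matrices.
Variables (R : realType) (X : finType) (e : rel X) (x : X).
Local Notation C := R[i].
Local Notation V := 'cV[C]_#|X|.
Local Notation A := (Adist R e).
Local Notation E := (Estar R e x).
Local Notation dx := (dist e x).
Local Notation D := (diameter e).

Lemma Estar_mulE i n (M : 'M[C]_(#|X|, n)) y z :
  (E i *m M) y z = (dx (enum_val y) == i)%:R * M y z.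
Proof.
rewrite mxE (bigD1 y) //= big1 ?addr0 ?mxE ?eqxx // => w /negPf yw.
by rewrite mxE eq_sym yw mul0r.
Qed.

Lemma mul_EstarE i n (M : 'M[C]_(n, #|X|)) y z :
  (M *m E i) y z = M y z * (dx (enum_val z) == i)%:R.
Proof.
rewrite mxE (bigD1 z) //= big1 ?addr0 ?mxE ?eqxx // => w /negPf yw.
by rewrite mxE yw mulr0.
Qed.

Lemma Estar_mulK i n (M : 'M[C]_(#|X|, n)) : E i *m (E i *m M) = E i *m M.
Proof.
by apply/matrixP => y z; rewrite !Estar_mulE; case: eqP; rewrite ?mul1r ?mul0r.
Qed.

Lemma Adist_tr i : simple_graph e -> connected_graph e -> (A i)^T = A i.
Proof. by move=> eS eC; apply/matrixP => y z; rewrite !mxE dist_sym. Qed.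

Lemma Estar_tr i : (E i)^T = E i.
Proof.
by apply/matrixP => y z; rewrite !mxE eq_sym; case: (y =P z) => // ->.
Qed.

Lemma innerZl a (u w : V) : inner (a *: u) w = a * inner u w.
Proof. by rewrite /inner mulr_sumr; apply: eq_bigr => y _; rewrite mxE mulrA. Qed.

Lemma innerZr a (u w : V) : inner u (a *: w) = a^* * inner u w.
Proof.
rewrite /inner mulr_sumr; apply: eq_bigr => y _.
by rewrite mxE rmorphM mulrCA.
Qed.

(** The two hypotheses say that [M] is real symmetric, hence Hermitian. *)
Lemma inner_sym_mul (M : 'M[C]_#|X|) (u w : V) :
  M^T = M -> map_mx Num.conj M = M -> inner (M *m u) w = inner u (M *m w).
Proof.
move=> /matrixP MT /matrixP Mc; rewrite /inner.
under eq_bigr do rewrite mxE mulr_suml.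
rewrite exchange_big; apply: eq_bigr => y _ /=.
rewrite mxE rmorph_sum mulr_sumr; apply: eq_bigr => z _.
rewrite rmorphM /= -[in RHS]MT mxE.
by have := Mc z y; rewrite mxE => ->; rewrite mulrAC mulrC mulrA.
Qed.

Lemma Adist_conj i : map_mx Num.conj (A i) = A i.
Proof. by apply/matrixP => y z; rewrite !mxE rmorph_nat. Qed.

Lemma Estar_conj i : map_mx Num.conj (E i) = E i.
Proof. by apply/matrixP => y z; rewrite !mxE rmorph_nat. Qed.

Lemma inner_EstarC i (u w : V) : inner (E i *m u) w = inner u (E i *m w).
Proof. by apply: inner_sym_mul; [exact: Estar_tr|exact: Estar_conj]. Qed.

Lemma inner_AdistC i (u w : V) : simple_graph e -> connected_graph e ->
  inner (A i *m u) w = inner u (A i *m w).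
Proof.
by move=> eS eC; apply: inner_sym_mul; [exact: Adist_tr|exact: Adist_conj].
Qed.

Lemma sqnorm_eq0 (u : V) : (sqnorm u == 0) = (u == 0).
Proof.
apply/eqP/eqP => [|->]; last first.
  by rewrite /sqnorm /inner big1 // => y _; rewrite mxE mul0r.
move/eqP; rewrite psumr_eq0 => [/allP u0|y _]; last exact: mul_conjC_ge0.
apply/matrixP => y z; rewrite ord1 mxE; apply/eqP.
by rewrite -mul_conjC_eq0; apply: u0; rewrite mem_index_enum.
Qed.

Lemma inner_Estar i j (u w : V) : i != j -> inner (E i *m u) (E j *m w) = 0.
Proof.
move=> /eqP ij; rewrite /inner big1 // => y _; rewrite !Estar_mulE.
case: eqP => [->|_]; last by rewrite !mul0r.
by case: eqP => // _; rewrite mul0r rmorph0 mulr0.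
Qed.

(** * Three-term relations, and blocks of the distance matrices between spheres around [x] *)

Section DistanceRegular.
Hypotheses (Gsimple : simple_graph e) (Gconn : connected_graph e).
Hypotheses (Gbip : bipartite_graph e) (Gdr : distance_regular e).
Local Notation c i := ((cnum e i)%:R : C).
Local Notation b i := ((bnum e i)%:R : C).

Lemma Adist0 : A 0 = 1%:M.
Proof.
by apply/matrixP => y z; rewrite !mxE dist_eq0 // (inj_eq enum_val_inj).
Qed.

Lemma Adist_oversize i : (D < i)%N -> A i = 0.
Proof.
move=> Di; apply/matrixP => y z; rewrite !mxE; case: eqP => // dyz.
by have := dist_le_diameter e (enum_val y) (enum_val z); rewrite dyz leqNgt Di.
Qed.

Lemma Adist1_mulE i y z :
  (A 1 *m A i) y z = (num_at e 1 i (enum_val y) (enum_val z))%:R.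
Proof.
rewrite mxE /num_at -sum1dep_card natr_sum.
rewrite (reindex (fun w : 'I_#|X| => enum_val w)); last first.
  by apply: onW_bij; exact: enum_val_bij.
rewrite [RHS]big_mkcond; apply: eq_bigr => w _; rewrite !mxE -natrM mulnb.
by case: (_ && _).
Qed.

(** No multiple of [A i.+1] occurs because the graph is bipartite. The relation holds for every [i],
    distance matrices beyond the diameter being zero. *)
Lemma Adist1_mul i : A 1 *m A i.+1 = b i *: A i + c i.+2 *: A i.+2.
Proof.
apply/matrixP => y z; rewrite Adist1_mulE !mxE.
set y' := enum_val y; set z' := enum_val z.
case: eqP => [dyz|/eqP n1].
  rewrite (bnum_num_at Gdr dyz) (_ : (_ == _) = false) ?mulr0 ?mulr1 ?addr0 //.
  by rewrite dyz; lia.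
case: eqP => [dyz|/eqP n2].
  by rewrite (cnum_num_at Gdr dyz) mulr0 add0r mulr1.
by rewrite (num_at_eq0 Gsimple Gconn Gbip) ?mulr0 ?addr0 //; left.
Qed.

Lemma Adist1_mul0 : A 1 *m A 0 = c 1 *: A 1.
Proof.
rewrite Adist0 mulmx1; have [D0|D0] := posnP D.
  by rewrite Adist_oversize ?D0 // scaler0.
by rewrite (cnum1 x) // scale1r.
Qed.

Lemma in_T_scale a (B : 'M[C]_#|X|) : in_T e x B -> in_T e x (a *: B).
Proof.
(* [T_lin] always adds a second member of the algebra, so a zero summand is manufactured as
   [- 1%:M + 1%:M]. *)
move=> TB; rewrite -[a *: B]addr0 -(addNr 1%:M) -[- 1%:M]scaleN1r.
by apply: T_lin => //; apply: T_lin; apply: T_one.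
Qed.

(** Up to the diameter [c i.+2] is invertible, and the three-term relation can be solved for
    [A i.+2]; beyond it the matrix is zero. *)
Lemma in_T_Adist i : in_T e x (A i).
Proof.
suff [] : in_T e x (A i) /\ in_T e x (A i.+1) by [].
elim: i => [|i [IH0 IH1]]; first by rewrite Adist0; split; constructor.
split=> //; have [Di|Di] := ltnP D i.+2.
  by rewrite Adist_oversize // -(scale0r 1%:M); apply: in_T_scale; constructor.
have c0 : c i.+2 != 0 by rewrite pnatr_eq0 -lt0n (cnum_gt0 x).
have -> : A i.+2 = (c i.+2)^-1 *: (- b i *: A i + A 1 *m A i.+1).
  by rewrite Adist1_mul scaleNr addKr scalerA mulVf // scale1r.
by apply/in_T_scale/T_lin => //; apply: T_mul => //; constructor.
Qed.

(** Only the block between the spheres of radius [i] and [k] survives, which reduces identities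
    between distance matrices to a finite list of possible distances. *)
Lemma eq_Estar_mul i k (M M' : 'M[C]_#|X|) :
  (forall y z, dx (enum_val y) = i -> dx (enum_val z) = k -> M y z = M' y z) ->
  E i *m M *m E k = E i *m M' *m E k.
Proof.
move=> MM'; apply/matrixP => y z; rewrite !mul_EstarE !Estar_mulE.
case: eqP => [yi|]; last by rewrite !mul0r.
by case: eqP => [zk|]; rewrite ?mulr0 // MM'.
Qed.

(** A bipartite graph has no edge inside a sphere around [x], so the adjacency matrix reaches the
    sphere of radius [h.+1] only from its two adjacent spheres. *)
Lemma Estar_mulA h n (u : 'M[C]_(#|X|, n)) :
  E h.+1 *m (A 1 *m u) =
  E h.+1 *m (A 1 *m (E h *m u)) + E h.+1 *m (A 1 *m (E h.+2 *m u)).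
Proof.
rewrite !mulmxA -mulmxDl; congr (_ *m u); apply/matrixP => y z.
rewrite [in RHS]mxE !mul_EstarE !Estar_mulE !mxE.
case: eqP => [yh|]; last by rewrite !mul0r addr0.
case: eqP => [yz|]; last by rewrite !mulr0 !mul0r addr0.
rewrite dist_sym // in yh.
have := dist_neighbor Gsimple Gconn Gbip yz yh.
rewrite dist_sym // !mul1r => -[->|[_ ->]]; rewrite eqxx.
  by rewrite (_ : (_ == _) = false) ?add0r //; lia.
by rewrite (_ : (_ == _) = false) ?addr0 //=; lia.
Qed.

Lemma Estar_Adist_Estar0 i j k : (j + k < i)%N -> E i *m A j *m E k = 0.
Proof.
move=> ijk; rewrite (@eq_Estar_mul _ _ _ 0) ?mulmx0 ?mul0mx // => y z dy dz.
rewrite !mxE; case: eqP => // dyz.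
have := dist_triangle Gconn (enum_val z) x (enum_val y).
by rewrite (dist_sym Gsimple Gconn (enum_val z)); lia.
Qed.

(** By the triangle inequality [dist e y z] and [dx y] differ by at most 2, and by parity their
    difference is even. *)
Lemma dist_cases2 y z : dx z = 2%N ->
  [\/ dist e y z = (dx y).+2, dist e y z = dx y /\ (0 < dx y)%N
    | (2 <= dx y)%N /\ dist e y z = (dx y).-2].
Proof.
move=> dz; have par := dist_parity Gconn Gbip x y z.
have t1 := dist_triangle Gconn x y z.
have t2 := dist_triangle Gconn y x z.
have t3 := dist_triangle Gconn z x y.
rewrite (dist_sym Gsimple Gconn z y) in t3.
rewrite (dist_sym Gsimple Gconn y x) dz in par t1 t2 t3.
move: (dist e y z) (dx y) par t1 t2 t3 => m n.
rewrite addbF => par t1 t2 t3.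
have : (m != n.+1) && (m != n.-1 :> nat) || (n == 0)%N.
  apply/orP; case: n par t1 t2 t3 => [|n] /=; first by right.
  move=> par _ _ _; left.
  by apply/andP; split; apply/eqP => mn; move: par; rewrite mn /=; case: odd.
case: (ltngtP m n) => [mn|nm|mn] H; first by apply: Or33; lia.
  by apply: Or31; lia.
by apply: Or32; lia.
Qed.

(** * Vectors on the sphere of radius 2 that [E 0 *m A 2] and [E 1 *m A 1] annihilate *)

Section Vector.
Variable v : V.
Hypotheses (E2v : E 2 *m v = v) (E0v : E 0 *m (A 2 *m v) = 0).
Hypothesis (E1v : E 1 *m (A 1 *m v) = 0).

(** Row [x] of [A 2] is the indicator of the sphere supporting [v], so [E0v] says that the entries
    of [v] sum to zero. *)
Lemma ones_mul : const_mx 1 *m v = 0 :> V.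
Proof.
have E0 : E 0 *m A 2 *m E 2 = E 0 *m const_mx 1 *m E 2.
  apply: eq_Estar_mul => y z /eqP; rewrite dist_eq0 // => /eqP xy dz.
  by rewrite !mxE -xy dz.
have := E0v; rewrite mulmxA -[v in LHS]E2v mulmxA E0 -mulmxA E2v -mulmxA.
move=> /matrixP/(_ (enum_rank x) 0); rewrite Estar_mulE enum_rankK.
rewrite (_ : dist e x x = 0%N) ?mul1r; last by apply/eqP; rewrite dist_eq0.
rewrite [RHS]mxE => s0; apply/matrixP => y z; rewrite ord1 [RHS]mxE -{}s0 !mxE.
by apply: eq_bigr => w _; rewrite !mxE.
Qed.

(** Between the spheres of radius [i.+2] and 2 the only distances are [i], [i.+2] and [i.+4]; there
    the three matrices add up to the all-ones matrix, which kills [v]. *)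
Lemma Estar_Adist_sum i :
  E i.+2 *m (A i *m v) + E i.+2 *m (A i.+2 *m v) = - (E i.+2 *m (A i.+4 *m v)).
Proof.
apply/eqP; rewrite -addr_eq0 -2!mulmxDr -2!mulmxDl.
have EJ : E i.+2 *m (A i + A i.+2 + A i.+4) *m E 2 = E i.+2 *m const_mx 1 *m E 2.
  apply: eq_Estar_mul => y z dy dz; rewrite !mxE.
  have := dist_cases2 (enum_val y) dz; rewrite dy /=.
  by case=> [->|[-> _]|[_ ->]]; rewrite ?eqxx;
    do ?[rewrite (_ : (_ == _) = false); last lia]; rewrite ?addr0 ?add0r.
by rewrite -[v]E2v mulmxA mulmxA EJ -(mulmxA _ _ v) E2v -mulmxA ones_mul mulmx0.
Qed.

(** Same argument between the spheres of radius 1 and 2, where only the distances 1 and 3 occur. *)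
Lemma Estar1_Adist3 : E 1 *m (A 3 *m v) = 0.
Proof.
rewrite -[LHS]add0r -E1v -mulmxDr -mulmxDl.
have EJ : E 1 *m (A 1 + A 3) *m E 2 = E 1 *m const_mx 1 *m E 2.
  apply: eq_Estar_mul => y z dy dz; rewrite !mxE.
  have := dist_cases2 (enum_val y) dz; rewrite dy /=.
  by case=> [->|[-> _]|[//]]; rewrite ?eqxx ?addr0 ?add0r.
by rewrite -[v]E2v mulmxA mulmxA EJ -(mulmxA _ _ v) E2v -mulmxA ones_mul mulmx0.
Qed.

Lemma Estar_Adist_vec0 i j : (j.+2 < i)%N -> E i *m (A j *m v) = 0.
Proof.
by move=> ji; rewrite -[v]E2v 2!mulmxA Estar_Adist_Estar0 ?mul0mx // addn2.
Qed.

(** Both unwanted terms, [E i.+4 *m (A i *m v)] and [E i.+3 *m (A i.-1 *m v)], vanish because [A j]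
    moves [v] at most [j] spheres outwards. *)
Lemma raise_vec i :
  E i.+3 *m (A 1 *m (E i.+2 *m (A i *m v))) =
  c i.+1 *: (E i.+3 *m (A i.+1 *m v)).
Proof.
have := Estar_mulA i.+2 (A i *m v).
rewrite (Estar_Adist_vec0 (i := i.+4)) // !mulmx0 addr0 => <-.
rewrite [A 1 *m _]mulmxA; case: i => [|i].
  by rewrite Adist1_mul0 -scalemxAl -scalemxAr.
rewrite Adist1_mul mulmxDl mulmxDr -!scalemxAl -!scalemxAr.
by rewrite (@Estar_Adist_vec0 i.+4 i) ?scaler0 ?add0r.
Qed.

(** The vector [A 1 *m (A j.+1 *m v)] is computed on the sphere of radius [i.+2] in two ways:
    through the adjacent spheres, and by the three-term relation. *)
Lemma Estar_three_term i j :
  E i.+2 *m (A 1 *m (E i.+3 *m (A j.+1 *m v)))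
   + E i.+2 *m (A 1 *m (E i.+1 *m (A j.+1 *m v))) =
  b j *: (E i.+2 *m (A j *m v)) + c j.+2 *: (E i.+2 *m (A j.+2 *m v)).
Proof.
rewrite addrC -Estar_mulA [A 1 *m _]mulmxA Adist1_mul.
by rewrite mulmxDl mulmxDr -!scalemxAl -!scalemxAr.
Qed.

End Vector.
End DistanceRegular.
End Matrices.

(** * Recurrence and sign of the values [P_i(0)] *)

Section PolynomialsAtZero.
Variables (X : finType) (e : rel X) (F : numFieldType) (D : nat).
Hypothesis c_gt0 : forall i, (0 < i <= D)%N -> (0 < cnum e i)%N.
Hypothesis b_gt0 : forall i, (i < D)%N -> (0 < bnum e i)%N.
Hypothesis c_add_b : forall i, (i <= D)%N -> (cnum e i + bnum e i)%N = valency e.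
Local Notation c i := ((cnum e i)%:R : F).
Local Notation b i := ((bnum e i)%:R : F).
Local Notation k := ((valency e)%:R : F).
Local Notation f := (fpoly e F).
Local Notation p := (ppoly e F).
Local Notation P := (Ppoly e F).

Lemma cnum_neq0 i : (0 < i <= D)%N -> c i != 0.
Proof. by move=> iD; rewrite pnatr_eq0 -lt0n c_gt0. Qed.

Lemma mulX_fpoly i : (i.+2 <= D)%N ->
  'X * f i.+1 = c i.+2 *: f i.+2 + b i *: f i.
Proof.
by move=> iD; rewrite [f i.+2]/= scalerA mulfV ?scale1r ?subrK // cnum_neq0.
Qed.

Lemma ppoly_recr i : p i.+2 = f i.+2 + p i.
Proof.
rewrite /ppoly big_mkcond 2!big_ord_recr -big_mkcond /= negbK eqxx addrC.
rewrite (_ : (_ == _) = false) ?addr0; last by case: odd.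
by congr (_ + _); apply: eq_bigl.
Qed.

(** The [p_i] satisfy the recurrence of the [f_i] with [b i.+2] in place of [b i]. Since
    [c i.+2 + b i.+2 = k], this amounts to ['X * p i.+1 = c i.+2 *: f i.+2 + k *: p i], which
    two-step induction proves by adding up the recurrence of the [f_i]. *)
Lemma mulX_ppoly i : (i.+2 <= D)%N ->
  'X * p i.+1 = c i.+2 *: p i.+2 + b i.+2 *: p i.
Proof.
move=> iD; rewrite ppoly_recr scalerDr -addrA -scalerDl -natrD c_add_b //.
suff [S _] : ((i.+2 <= D)%N -> 'X * p i.+1 = c i.+2 *: f i.+2 + k *: p i) /\
   ((i.+3 <= D)%N -> 'X * p i.+2 = c i.+3 *: f i.+3 + k *: p i.+1) by apply: S.
have p0 : p 0 = f 0 by rewrite /ppoly big_mkcond big_ord1.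
have p1 : p 1 = f 1.
  by rewrite /ppoly big_mkcond 2!big_ord_recr big_ord0 /= !add0r.
elim: i {iD} => [|i [IH0 IH1]].
  split=> iD; first by rewrite p1 p0 mulX_fpoly.
  rewrite ppoly_recr mulrDr mulX_fpoly // p0 p1 -addrA; congr (_ + _).
  rewrite -(c_add_b (i := 1)); last by lia.
  rewrite addnC natrD scalerDl; congr (_ + _).
  by rewrite [f 1]/= scalerA mulfV ?scale1r // cnum_neq0 //; lia.
split=> // iD; rewrite ppoly_recr mulrDr mulX_fpoly // IH0; last by lia.
have kE : k *: f i.+2 = b i.+2 *: f i.+2 + c i.+2 *: f i.+2.
  by rewrite -scalerDl -natrD addnC c_add_b //; lia.
by rewrite ppoly_recr scalerDr kE !addrA.
Qed.

Lemma horner_Ppoly0 i : (P i).[0] = (p i)`_(odd i).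
Proof.
rewrite horner_coef0 /Ppoly; case: ifP => _; last by rewrite coef_even_poly.
by rewrite coef_odd_poly.
Qed.

(** Compare coefficients of degree [odd i] in [mulX_ppoly]: for odd [i] the left side contributes
    the constant term of [p i.+1], for even [i] nothing. *)
Lemma Ppoly0_rec i : (i.+2 <= D)%N ->
  c i.+2 * (P i.+2).[0] = (odd i)%:R * (P i.+1).[0] - b i.+2 * (P i).[0].
Proof.
move=> iD; have /(congr1 (fun q : {poly F} => q`_(odd i))) := mulX_ppoly iD.
rewrite coefD !coefZ coefXM !horner_Ppoly0 /= negbK => pE.
apply/esym/(canLR (addrK _)); rewrite -pE.
by case: (odd i); rewrite ?mul1r ?mul0r.
Qed.

Lemma Ppoly0_0 : (P 0).[0] = 1.
Proof. by rewrite horner_Ppoly0 /ppoly big_mkcond big_ord1 /= coef1. Qed.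

Lemma Ppoly0_1 : (P 1).[0] = (c 1)^-1.
Proof.
rewrite horner_Ppoly0 /ppoly big_mkcond 2!big_ord_recr big_ord0 /= !add0r.
by rewrite mulr1 coefZ coefX mulr1.
Qed.

(** With this sign both terms of [Ppoly0_rec] become nonnegative: for odd [i] the half of [i.+1] is
    the half of [i.+2], and the sign of the second term changes once. *)
Lemma Ppoly0_sign i : (i < D)%N -> 0 < (-1) ^+ i./2 * (P i).[0].
Proof.
suff [S _] : ((i < D)%N -> 0 < (-1) ^+ i./2 * (P i).[0]) /\
  ((i.+1 < D)%N -> 0 < (-1) ^+ i.+1./2 * (P i.+1).[0]) by [].
elim: i => [|i [IH0 IH1]].
  rewrite Ppoly0_0 Ppoly0_1 !mul1r; split=> iD; first exact: ltr01.
  by rewrite invr_gt0 ltr0n c_gt0 ?(ltnW iD).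
split=> // iD; have c0 : 0 < c i.+2 by rewrite ltr0n c_gt0 //; lia.
have b0 : 0 < b i.+2 by rewrite ltr0n b_gt0.
rewrite -(pmulr_rgt0 _ c0) mulrCA Ppoly0_rec; last by lia.
have -> : (-1) ^+ i.+2./2 * ((odd i)%:R * (P i.+1).[0] - b i.+2 * (P i).[0])
  = b i.+2 * ((-1) ^+ i./2 * (P i).[0])
    + (odd i)%:R * ((-1) ^+ i.+1./2 * (P i.+1).[0]).
  by rewrite /= uphalf_half exprS; case: (odd i); rewrite /= ?exprS; ring.
apply: ltr_wpDr; last by rewrite mulr_gt0 // IH0 //; lia.
by rewrite mulr_ge0 ?ler0n // ltW // IH1 //; lia.
Qed.

Lemma Ppoly0_neq0 i : (i < D)%N -> (P i).[0] != 0.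
Proof.
by move=> /Ppoly0_sign; apply: contraTneq => ->; rewrite mulr0 ltxx.
Qed.

End PolynomialsAtZero.

(** * Symmetry of the spectrum and vanishing of the middle eigenvalue *)

Section MiddleEigenvalue.
Variables (R : realType) (X : finType) (e : rel X) (x : X).
Hypotheses (Gsimple : simple_graph e) (Gconn : connected_graph e).
Hypotheses (Gbip : bipartite_graph e).

(** Changing the sign of an eigenvector on one side of the bipartition negates its eigenvalue. *)
Lemma eigenvalue_opp (z : R[i]) :
  eigenvalue (Adist R e 1) z -> eigenvalue (Adist R e 1) (- z).
Proof.
have [S bS] := Gbip.
pose s (w : 'I_#|X|) : R[i] := (-1) ^+ (enum_val w \in S).
move=> /eigenvalueP[u uA u0]; apply/eigenvalueP; exists (\row_w (u 0 w * s w)).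
  apply/rowP => w; have /rowP/(_ w) := uA; rewrite !mxE => uAw.
  have -> : - z * (u 0 w * s w) = - (z * u 0 w) * s w by ring.
  rewrite -uAw -sumrN mulr_suml; apply: eq_bigr => y _; rewrite !mxE.
  case: (dist e (enum_val y) (enum_val w) =P 1%N) => [yw|];
    last by rewrite !mulr0 oppr0 mul0r.
  have := odd_dist Gconn bS (enum_val y) (enum_val w); rewrite yw /s.
  by case: (_ \in S); case: (_ \in S) => //= _; rewrite ?expr0 ?expr1; ring.
apply: contraNneq u0 => /rowP u0; apply/eqP/rowP => w.
have := u0 w; rewrite !mxE => /eqP; rewrite mulf_eq0 signr_eq0 orbF.
by move/eqP.
Qed.

Lemma middle_eigenvalue (theta : nat -> R) d :
  ordered_eigenvalues e theta -> diameter e = d.*2 -> theta d = 0.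
Proof.
move=> [dec eig] Dd; set n := d.*2.+1.
(* Reversing and negating the spectrum gives a strictly decreasing list with the same members, hence
   the same list; its middle entry then equals its own negative. *)
pose s := mkseq theta n; pose t := [seq - a | a <- rev s].
have decs : sorted >%R s.
  apply/(sortedP 0) => i; rewrite size_mkseq => iD.
  by rewrite !nth_mkseq ?(ltnW iD) //; apply: dec; rewrite Dd ltnSn -ltnS.
have dect : sorted >%R t.
  rewrite /t sorted_map rev_sorted; apply: sub_sorted decs => a a' /=.
  by rewrite ltrN2.
have mems a : (a \in s) = eigenvalue (Adist R e 1) a%:C%C.
  apply/mapP/idP => [[j]|/eig [j jD /complexI ->]].
    by rewrite mem_iota => jD ->; apply/eig; exists j; rewrite ?Dd.
  by exists j => //; rewrite mem_iota /= add0n ltnS -Dd.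
have memN a : (a \in s) -> (- a \in s).
  by rewrite !mems rmorphN => /eigenvalue_opp.
have st : s = t.
  apply: (irr_sorted_eq (leT := >%R)) => //.
  - by move=> a a' a'' /= h1 h2; apply: lt_trans h1.
  - by move=> a /=; rewrite ltxx.
  move=> a; rewrite -[a in RHS]opprK (mem_map oppr_inj) mem_rev.
  by apply/idP/idP => /memN; rewrite ?opprK.
have : s`_d = t`_d by rewrite -st.
have dn : (d < n)%N by rewrite ltnS -addnn leq_addr.
rewrite [RHS](nth_map 0) ?size_rev ?size_mkseq // nth_rev ?size_mkseq //.
rewrite (_ : (n - d.+1)%N = d); last by rewrite subSS -addnn addnK.
rewrite nth_mkseq // => /eqP; rewrite -subr_eq0 opprK -mulr2n mulrn_eq0.
by move/eqP.
Qed.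

End MiddleEigenvalue.

(** * Closed forms of the scalars in the induction, with [Q i] standing for [P_i(0)] *)

Section Coefficients.
Variables (F : fieldType) (b c Q : nat -> F).

(** Closed form of the scalar [Y_i] with [E*_{i+2} A_{i+4} v = - Y_i g_i]. *)
Definition Ycoef i := - (b i.+2 * b i.+3 / (c i.+1 * c i.+2)) * (Q i / Q i.+2).

(** The scalar [K_i] with [E*_{i+2} A E*_{i+1} A_{i+3} v = - K_i g_i]; it is 0 at [i = 0] because
    [E*_1 A_3 v = 0]. *)
Definition Kcoef i := if i is j.+1 then c i * Ycoef j else 0.

Definition Lcoef i := b i.+2 + c i.+2 * Ycoef i - Kcoef i.

Variable D : nat.
Hypothesis c_neq0 : forall i, (0 < i <= D)%N -> c i != 0.
Hypothesis b_neq0 : forall i, (i < D)%N -> b i != 0.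
Hypothesis Q_neq0 : forall i, (i < D)%N -> Q i != 0.
Hypothesis c1Q1 : c 1 * Q 1 = Q 0.
Hypothesis Q_rec : forall i, (i.+2 <= D)%N ->
  c i.+2 * Q i.+2 = (odd i)%:R * Q i.+1 - b i.+2 * Q i.

Lemma LcoefE i : (i.+3 < D)%N ->
  Lcoef i = b i.+2 * c i.+3 / c i.+1 * (Q i.+3 * Q i / (Q i.+1 * Q i.+2)).
Proof.
move=> iD.
(* The recurrence for [Q i.+1] trades [Q i.-1] for [Q i.+1] and [Q i], which also covers [i = 0]
   through [c1Q1]. In [Lcoef] the term [b i.+2] then cancels, and what remains is the recurrence for
   [Q i.+3]. *)
have KE : Kcoef i * (c i.+1 * Q i.+1) =
    b i.+2 * (c i.+1 * Q i.+1 - (~~ odd i)%:R * Q i).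
  case: i iD => [|i] iD; first by rewrite mul0r c1Q1 mul1r subrr mulr0.
  have ci : c i.+1 != 0 by apply: c_neq0; lia.
  have ci1 : c i.+2 != 0 by apply: c_neq0; lia.
  have Qi : Q i.+2 != 0 by apply: Q_neq0; lia.
  rewrite /= negbK [in RHS]Q_rec; last by lia.
  by rewrite /Ycoef; field; rewrite ci ci1 Qi.
have c1 : c i.+1 != 0 by apply: c_neq0; lia.
have c2 : c i.+2 != 0 by apply: c_neq0; lia.
have Q1 : Q i.+1 != 0 by apply: Q_neq0; lia.
have Q2 : Q i.+2 != 0 by apply: Q_neq0; lia.
have -> : b i.+2 * c i.+3 / c i.+1 * (Q i.+3 * Q i / (Q i.+1 * Q i.+2)) =
    (c i.+3 * Q i.+3) * (b i.+2 * Q i / (c i.+1 * Q i.+1 * Q i.+2)).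
  by field; rewrite c1 Q1 Q2.
have {KE} -> : Lcoef i = b i.+2 + c i.+2 * Ycoef i -
    b i.+2 * (c i.+1 * Q i.+1 - (~~ odd i)%:R * Q i) / (c i.+1 * Q i.+1).
  by rewrite -KE mulfK // mulf_neq0.
rewrite Q_rec; last by lia.
by rewrite /Ycoef /=; field; rewrite c1 c2 Q1 Q2.
Qed.

Lemma Lcoef_neq0 i : (i.+3 < D)%N -> Lcoef i != 0.
Proof.
move=> iD; rewrite LcoefE // !(mulf_neq0, invr_eq0) ?c_neq0 ?b_neq0 ?Q_neq0;
lia.
Qed.

Lemma Ycoef_Lcoef i : (i.+3 < D)%N -> Ycoef i.+1 * Lcoef i = b i.+4 * Ycoef i.
Proof.
move=> iD; rewrite LcoefE // /Ycoef.
have c1 : c i.+1 != 0 by apply: c_neq0; lia.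
have c2 : c i.+2 != 0 by apply: c_neq0; lia.
have c3 : c i.+3 != 0 by apply: c_neq0; lia.
have Q1 : Q i.+1 != 0 by apply: Q_neq0; lia.
have Q2 : Q i.+2 != 0 by apply: Q_neq0; lia.
have Q3 : Q i.+3 != 0 by apply: Q_neq0; lia.
by field; rewrite c1 c2 c3 Q1 Q2 Q3.
Qed.

(** Multiplication by [L_i] advances the index of the factor in the norm formula; the leftover [b i]
    is absorbed by [k_{i+1} c_{i+1} = k_i b_i]. *)
Lemma Lcoef_ratio i : (i.+3 < D)%N ->
  Lcoef i * (b i * b i.+1 * c i.+1 * c i.+2 * (Q i.+2 / Q i)) =
  b i * (b i.+1 * b i.+2 * c i.+2 * c i.+3 * (Q i.+3 / Q i.+1)).
Proof.
move=> iD; rewrite LcoefE //.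
have c1 : c i.+1 != 0 by apply: c_neq0; lia.
have Q0 : Q i != 0 by apply: Q_neq0; lia.
have Q1 : Q i.+1 != 0 by apply: Q_neq0; lia.
have Q2 : Q i.+2 != 0 by apply: Q_neq0; lia.
by field; rewrite c1 Q0 Q1 Q2.
Qed.

End Coefficients.

(** * Norms in a thin module of endpoint 2, by induction on the sphere *)

Definition norm_coef (X : finType) (e : rel X) (F : numFieldType) i : F :=
  - (kval e F i * (bnum e i)%:R * (bnum e i.+1)%:R
     * (cnum e i.+1)%:R * (cnum e i.+2)%:R
     / ((valency e)%:R * (bnum e 1)%:R * (bnum e 2)%:R))
  * ((Ppoly e F i.+2).[0] / (Ppoly e F i).[0]).

Section ThinModule.
Variables (R : realType) (X : finType) (e : rel X) (x : X).
Local Notation C := R[i].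
Local Notation V := 'cV[C]_#|X|.
Local Notation A := (Adist R e).
Local Notation E := (Estar R e x).
Local Notation D := (diameter e).
Local Notation c i := ((cnum e i)%:R : C).
Local Notation b i := ((bnum e i)%:R : C).
Local Notation cc := (fun i => c i).
Local Notation bb := (fun i => b i).
Local Notation Q i := ((Ppoly e C i).[0]).
Local Notation QQ := (fun i => Q i).
Local Notation N := (norm_coef e C).
Hypotheses (Gsimple : simple_graph e) (Gconn : connected_graph e).
Hypotheses (Gbip : bipartite_graph e) (Gdr : distance_regular e).
Variables (W : {vspace V}) (v : V).
Hypotheses (W_mod : T_module e x W) (W_thin : thin e x W).
Hypotheses (W_end : has_endpoint e x W 2) (v_in : v \in EW e x W 2).

Lemma EW_mem i (B : 'M[C]_#|X|) w :
  in_T e x B -> w \in W -> E i *m (B *m w) \in EW e x W i.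
Proof.
move=> TB wW; have -> : E i *m (B *m w) = linfun (mulmx (E i)) (B *m w).
  by rewrite lfunE.
by apply: memv_img; apply: W_mod.
Qed.

Lemma EW_lt_endpoint i w : (i < 2)%N -> w \in EW e x W i -> w = 0.
Proof.
move=> i2; have [_ Wi] := W_end.
have /eqP -> : EW e x W i == 0%VS by apply: contraTT i2 => /Wi; rewrite -leqNgt.
by rewrite memv0 => /eqP.
Qed.

Lemma EW2P : (2 <= D)%N -> E 2 *m v = v /\ v \in W.
Proof.
move=> D2; have /memv_imgP[w wW vE] := v_in; rewrite lfunE /= in vE.
by rewrite vE Estar_mulK W_mod //; constructor.
Qed.

Lemma thin_line i u w : (i <= D)%N -> u \in EW e x W i -> u != 0 ->
  w \in EW e x W i -> exists a, w = a *: u.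
Proof.
move=> iD uW u0 wW; apply/vlineP; suff -> : (<[u]> = EW e x W i)%VS by [].
by apply/eqP; rewrite eqEdim -memvE uW dim_vline u0 W_thin.
Qed.

Local Notation g i := (E i.+2 *m (A i *m v)).

(** The inner product of [A 1 *m g i] with [g i.+1] is evaluated on either side of the self-adjoint
    [A 1]; the real number [c i.+1] passes through the conjugation. *)
Lemma sqnorm_raise i (a : C) :
  E 2 *m v = v ->
  E i.+2 *m (A 1 *m g i.+1) = a *: g i ->
  c i.+1 * sqnorm (g i.+1) = a * sqnorm (g i).
Proof.
move=> E2v Lg; rewrite /sqnorm -[RHS]innerZl -Lg -[c _]conjC_nat -innerZr.
rewrite -(raise_vec Gsimple Gconn Gbip Gdr E2v).
rewrite -inner_EstarC Estar_mulK -(inner_AdistC 1 _ _ Gsimple Gconn).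
by rewrite -[g i in LHS]Estar_mulK -inner_EstarC.
Qed.

Hypotheses (D4 : (4 <= D)%N) (v_neq0 : v != 0).
Hypothesis v_eig : E 2 *m (A 2 *m v) = (b 3 - 1) *: v.

Let cN0 i : (0 < i <= D)%N -> c i != 0.
Proof. by move=> iD; rewrite pnatr_eq0 -lt0n (cnum_gt0 x). Qed.

Let bN0 i : (i < D)%N -> b i != 0.
Proof. by move=> iD; rewrite pnatr_eq0 -lt0n (bnum_gt0 x). Qed.

Let cb i : (i <= D)%N -> c i + b i = (valency e)%:R.
Proof. by move=> iD; rewrite -natrD (cnum_add_bnum x). Qed.

Let QN0 i : (i < D)%N -> Q i != 0.
Proof.
apply: Ppoly0_neq0 => j jD; [exact: (cnum_gt0 x)|exact: (bnum_gt0 x)|].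
exact: (cnum_add_bnum x).
Qed.

Let Qrec i : (i.+2 <= D)%N ->
  c i.+2 * Q i.+2 = (odd i)%:R * Q i.+1 - b i.+2 * Q i.
Proof.
apply: Ppoly0_rec => j jD; [exact: (cnum_gt0 x)|exact: (cnum_add_bnum x)].
Qed.

Let cQ1 : c 1 * Q 1 = Q 0.
Proof. by rewrite Ppoly0_1 Ppoly0_0 mulfV // cN0 //; lia. Qed.

Lemma norm_coef_rec i : (i.+3 < D)%N -> c i.+1 * N i.+1 = Lcoef bb cc QQ i * N i.
Proof.
move=> iD; have c1 : c i.+1 != 0 by apply: cN0; lia.
have kE : kval e C i.+1 * c i.+1 = kval e C i * b i.
  have kn0 j : (j <= D)%N -> \prod_(1 <= m < j.+1) c m != 0.
    move=> jD; rewrite prodf_seq_neq0; apply/allP => m.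
    by rewrite mem_index_iota => mj; apply/implyP=> _; apply: cN0; lia.
  rewrite /kval big_nat_recr //= [in X in _ / X]big_nat_recr //=.
  have kn : \prod_(1 <= m < i.+1) c m != 0 by apply: kn0; lia.
  by field; rewrite c1 kn.
have LR := Lcoef_ratio (b := bb) (c := cc) (Q := QQ) cN0 QN0 cQ1 Qrec iD.
cbv beta in LR; rewrite /norm_coef; set n := _ * b 1 * b 2.
rewrite [RHS](_ : _ = - (kval e C i / n) *
  (Lcoef bb cc QQ i * (b i * b i.+1 * c i.+1 * c i.+2 * (Q i.+2 / Q i))));
  last by ring.
rewrite LR [RHS](_ : _ = - (kval e C i * b i) / n *
  (b i.+1 * b i.+2 * c i.+2 * c i.+3 * (Q i.+3 / Q i.+1))); last by ring.
by rewrite -kE; ring.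
Qed.

Lemma Ppoly0_2 : Q 2 = - b 2 / c 2.
Proof.
have D2 : (2 <= D)%N by lia.
have := Qrec D2; rewrite mul0r add0r Ppoly0_0 mulr1 => QE.
by apply: (mulfI (cN0 (i := 2) D2)); rewrite QE; field; apply: cN0.
Qed.

Lemma norm_coef0 : N 0 = 1.
Proof.
rewrite /norm_coef /kval !big_geq // (cnum1 x) //; last by lia.
have b0 : (valency e)%:R != 0 :> C by apply: (bN0 (i := 0)); lia.
have b1 : b 1 != 0 by apply: bN0; lia.
have b2 : b 2 != 0 by apply: bN0; lia.
have c2 : c 2 != 0 by apply: cN0; lia.
by rewrite -/(valency e) Ppoly0_2 Ppoly0_0; field; rewrite b0 b1 b2 c2.
Qed.

Lemma thin_module_norm i : (i.+3 <= D)%N -> sqnorm (g i) = N i * sqnorm v.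
Proof.
have [|E2v vW] := EW2P; first by lia.
have TA j : in_T e x (A j) by apply: in_T_Adist.
have E0v : E 0 *m (A 2 *m v) = 0 by apply: (@EW_lt_endpoint 0); rewrite ?EW_mem.
have E1v : E 1 *m (A 1 *m v) = 0 by apply: (@EW_lt_endpoint 1); rewrite ?EW_mem.
have sumg := Estar_Adist_sum Gsimple Gconn Gbip E2v E0v.
have raise := raise_vec Gsimple Gconn Gbip Gdr E2v.
pose Y := Ycoef bb cc QQ; pose K := Kcoef bb cc QQ; pose L := Lcoef bb cc QQ.
(* The norm formula alone does not propagate: the last two clauses determine [L_j], and [g j != 0]
   allows coefficients of [g j] to be compared. *)
pose IH j := [/\ g j != 0, sqnorm (g j) = N j * sqnorm v,
  E j.+2 *m (A j.+4 *m v) = - Y j *: g j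
  & E j.+2 *m (A 1 *m (E j.+1 *m (A j.+3 *m v))) = - K j *: g j].
move=> iD; suff [] : IH i by [].
elim: i iD => [|i IHi] iD.
  rewrite /IH norm_coef0 mul1r (Adist0 R Gconn) mul1mx E2v; split=> //.
    (* On the sphere of radius 2 the sum relation reads [v + (b_3 - 1) v = - E*_2 A_4 v], so the
       claim is [Y_0 = b_3]. *)
    apply: oppr_inj; rewrite -sumg (Adist0 R Gconn) mul1mx E2v v_eig.
    rewrite -[X in X + _]scale1r -scalerDl subrKC -scaleNr opprK; congr (_ *: _).
    rewrite /Y /Ycoef Ppoly0_2 Ppoly0_0 (cnum1 x) //; last by lia.
    have b2 : b 2 != 0 by apply: bN0; lia.
    have c2 : c 2 != 0 by apply: cN0; lia.
    by field; rewrite b2 c2.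
  by rewrite (Estar1_Adist3 Gsimple Gconn Gbip E2v E0v E1v) !mulmx0 oppr0 scale0r.
have [|g0 sg Yg Kg] := IHi; first by lia.
have w2 : E i.+2 *m (A i.+2 *m v) = (Y i - 1) *: g i.
  have := sumg i; rewrite Yg -scaleNr opprK scalerBl scale1r => <-.
  by rewrite addrC addKr.
(* At [i = 0] both sides vanish, by [E1v] and [c_0 = 0]; otherwise the sum relation on the previous
   sphere splits the inner vector into a raised part and the part known from [Kg]. *)
have w1 : E i.+2 *m (A 1 *m (E i.+1 *m (A i.+1 *m v))) = (K i - c i) *: g i.
  case: i {IHi iD sg Yg g0 w2} Kg => [|i] Kg.
    by rewrite E1v !mulmx0 subrr scale0r.
  have -> : E i.+2 *m (A i.+2 *m v) = - g i - E i.+2 *m (A i.+4 *m v).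
    by rewrite -sumg addKr.
  by rewrite 2!mulmxBr 2!mulmxN raise Kg scaleNr opprK scalerBl addrC.
(* Since [c_h + b_h] is constant, the outer coefficients of the three-term relations can be
   expressed so that they combine with [L i] and [b i.+4]. *)
have cb2 : b i = c i.+2 + b i.+2 - c i.
  rewrite (cb (i := i.+2)); last by lia.
  by rewrite -(cb (i := i)) ?[c i + _]addrC ?addrK //; lia.
have cb4 : c i.+4 = c i.+2 + b i.+2 - b i.+4.
  rewrite (cb (i := i.+2)); last by lia.
  by rewrite -(cb (i := i.+4)) ?addrK.
have Lg : E i.+2 *m (A 1 *m g i.+1) = L i *: g i.
  have := Estar_three_term x Gsimple Gconn Gbip Gdr v i i.
  rewrite w1 w2 scalerA => /(canRL (addrK _)) ->.
  rewrite -scalerDl -scalerBl; congr (_ *: _); rewrite /L /Lcoef -/(Y i) -/(K i).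
  by rewrite cb2; ring.
have c1 : c i.+1 != 0 by apply: cN0; lia.
have L0 : L i != 0 by apply: (Lcoef_neq0 cN0 bN0 QN0 cQ1 Qrec iD).
have cg := sqnorm_raise E2v Lg.
have g1 : g i.+1 != 0.
  by rewrite -sqnorm_eq0 -(mulrI_eq0 _ (mulfI c1)) cg mulf_neq0 ?sqnorm_eq0.
(* Thinness enters here: [g i.+1], now known to be nonzero, spans its component of [W]. The scalar
   [a] is identified below as [- Y i.+1]. *)
have [a aE] : exists a, E i.+3 *m (A i.+4.+1 *m v) = a *: g i.+1.
  by apply: (thin_line (i := i.+3)) g1 _; [lia|apply: EW_mem|apply: EW_mem].
have w3 : E i.+3 *m (A i.+3 *m v) = (- a - 1) *: g i.+1.
  by rewrite scalerBl scale1r scaleNr -aE -sumg addrAC subrr add0r.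
split; first exact: g1.
- by apply: (mulfI c1); rewrite cg sg [LHS]mulrA [RHS]mulrA norm_coef_rec.
(* The relation with [j = i.+2] becomes an equation between multiples of [g i]; it gives
   [a * L i = - b_{i+4} Y_i], and [L i] cancels. *)
- rewrite aE; congr (_ *: _); apply: (mulIf L0).
  have := Estar_three_term x Gsimple Gconn Gbip Gdr v i i.+2.
  rewrite w3 -!scalemxAr Lg Kg w2 Yg !scalerA -!scalerDl.
  move/eqP; rewrite -subr_eq0 -scalerBl scaler_eq0 (negPf g0) orbF subr_eq0.
  move=> /eqP eqL; rewrite mulNr (Ycoef_Lcoef cN0 QN0 cQ1 Qrec iD) -/(Y i).
  have LE : L i = b i.+2 + c i.+2 * Y i - K i by [].
  have -> : a * L i = - L i + K i * 0 - ((- a - 1) * L i + - K i) - K i by ring.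
  by rewrite eqL LE cb4; ring.
rewrite Yg -!scalemxAr raise scalerA; congr (_ *: _).
by rewrite /K /Kcoef -/(Y i); ring.
Qed.

End ThinModule.

Theorem theorem14p5 (R : realType) (X : finType) (e : rel X) (D d : nat)
    (theta : nat -> R) (x : X)
    (W : {vspace 'cV[R[i]]_#|X|}) (v : 'cV[R[i]]_#|X|)
    (Gsimple : simple_graph e) (Gconn : connected_graph e)
    (Gbip : bipartite_graph e) (Gdr : distance_regular e)
    (D_diam : diameter e = D) (D_ge4 : (4 <= D)%N) (D_even : ~~ odd D)
    (d_half : d = D./2) (k_ge3 : (3 <= valency e)%N)
    (theta_eig : ordered_eigenvalues e theta)
    (W_irr : T_irreducible e x W) (W_thin : thin e x W)
    (W_end : has_endpoint e x W 2)
    (W_loc : has_local_eigenvalue e x W (tilde_eig e (theta d)%:C%C))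
    (v_in : v \in EW e x W 2) (v_neq0 : v != 0) :
  let c := fun i : nat => (cnum e i)%:R : R[i] in
  let b := fun i : nat => (bnum e i)%:R : R[i] in
  let k := (valency e)%:R : R[i] in
  let P := Ppoly e R[i] in
  let u := fun i : nat => Estar R e x (i + 2) *m Adist R e i *m v in
  (forall i j, (i <= D - 3)%N -> (j <= D - 3)%N -> i != j ->
     inner (u i) (u j) = 0) /\
  (forall i, (i <= D - 3)%N ->
     sqnorm (u i) =
       - (kval e R[i] i * b i * b i.+1 * c i.+1 * c i.+2 / (k * b 1%N * b 2%N))
         * ((P i.+2).[0] / (P i).[0]) * sqnorm v).
Proof.
move=> c b k P u; split=> [i j _ _ ij|i iD].
  (* Orthogonality only reflects that the vectors are supported on different spheres around [x]. *)
  by rewrite /u -!mulmxA inner_Estar // eqn_add2r.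
have [W_mod _ _] := W_irr; subst D.
have theta0 : theta d = 0.
  by apply: (middle_eigenvalue Gconn Gbip theta_eig); rewrite d_half even_halfK.
have [|E2v _] := EW2P W_mod v_in; first by lia.
(* At [theta d = 0] the local eigenvalue is [-1 + b_2 b_3 / b_2], which simplifies to [b_3 - 1] once
   [b_2] is nonzero. *)
have b2 : b 2%N != 0 by rewrite pnatr_eq0 -lt0n (bnum_gt0 x) //; lia.
rewrite /u addn2 -mulmxA.
apply: (thin_module_norm Gsimple Gconn Gbip Gdr W_mod) => //; last by lia.
have := W_loc v v_in; rewrite -!mulmxA E2v => ->; congr (_ *: _).
by rewrite theta0 /tilde_eig expr0n sub0r -/(b 2%N) -/(b 3%N); field.
Qed.
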